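(* Let $r\ge1$ and let $\widetilde{A_{1,r}}$ be the quiver on vertices $1,\dots,r+1$ with an edge $i\to i+1$ for each $1\le i\le r$ and an additional edge $1\to r+1$, with mutation sequence $1,\dots,r+1,1,\dots,r+1,\dots$. Let $S_\infty$ denote the limit (as a formal power series) of the deformed $F$-polynomials $S_n$ as $n\to\infty$ within a fixed residue class modulo $r+1$. Then, up to a cyclic shift of the variables $y_1,\dots,y_{r+1}$ (depending on the residue class), $$S_\infty=1+\frac{y_{r+1}+y_{r+1}y_r+\cdots+y_{r+1}y_r\cdots y_2}{(1-y_1y_2\cdots y_{r+1})^2}.$$
   Context: Quiver mutation at $k$: for every path $i\to k\to j$ add an arrow $i\to j$, reverse all arrows incident to $k$, then delete all 2-cycles. The framed quiver has additional frozen vertices $i'$ with one arrow $i'\to i$ for each base vertex $i$; only base vertices are mutated. Initially each base vertex has label $1$ and $i'$ has label $y_i$; mutating at $k$ replaces the label $V_k$ by (product of labels over arrows into $k$ + product of labels over arrows out of $k$, with multiplicity)$/V_k$. The $F$-polynomial $F_n$ is the label at the vertex mutated at step $n$, right after step $n$. The $C$-matrix $C_n$ is the invertible integer matrix whose $(i,j)$ entry is the number of arrows $i'\to j$ (negative if they go $j\to i'$) after $n$ mutations. For a square matrix $M$ and a polynomial $P$ in the $y_i$, $M(P)$ is obtained by replacing each monomial $y^e$ by $y^{Me}$; the deformed $F$-polynomial is $S_n=(-C_n^{-1})(F_n)$. Convergence means that each coefficient is eventually constant. For $r=1$ the quiver has two arrows from $1$ to $2$, and the numerator is $y_2$. *)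

(* Defs.v *)
From mathcomp Require Import all_boot all_order all_algebra.
From mathcomp Require Export fraction.
From mathcomp.multinomials Require Export mpoly.

Set Implicit Arguments.
Unset Strict Implicit.
Unset Printing Implicit Defensive.

Import GRing.Theory.
Local Open Scope ring_scope.

Definition quiver (V : Type) := V -> V -> nat.

Section Mutation.
Variable V : finType.
Implicit Types (q : quiver V) (k : V).

Definition add_paths k q : quiver V :=
  fun i j => (q i j + q i k * q k j)%N.

Definition reverse_at k q : quiver V :=
  fun i j => if (i == k) || (j == k) then q j i else q i j.

(* Truncated subtraction: a maximal family of disjoint 2-cycles between i and
   j has minn (q i j) (q j i) members. *)
Definition delete_2cycles q : quiver V := fun i j => (q i j - q j i)%N.

Definition mutate k q : quiver V :=
  delete_2cycles (reverse_at k (add_paths k q)).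

Definition mutate_label (K : fieldType) k q (x : V -> K) : V -> K :=
  fun v => if v == k
           then (\prod_u x u ^+ q u k + \prod_u x u ^+ q k u) / x k
           else x v.
End Mutation.

(* Base vertex i is [inl i]; its frozen copy i' is [inr i]. *)
Definition framed (n : nat) (q : quiver 'I_n) : quiver ('I_n + 'I_n)%type :=
  fun u v => match u, v with
             | inl i, inl j => q i j
             | inr i, inl j => nat_of_bool (i == j)
             | _, inr _ => 0%N
             end.

Section FramedSeeds.
Variables (n : nat) (q0 : quiver 'I_n) (mu : nat -> 'I_n).

Definition labels : Type := ('I_n + 'I_n)%type -> {fraction {mpoly int[n]}}.

Definition initial_labels : labels :=
  fun v => match v with
           | inl _ => 1
           | inr i => tofrac ('X_i : {mpoly int[n]})
           end.

(* [mu t] is the vertex mutated at step t, for t >= 1. *)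
Fixpoint seed (t : nat) : quiver ('I_n + 'I_n)%type * labels :=
  if t is t'.+1 then
    let: (q, x) := seed t' in
    (mutate (inl (mu t)) q, mutate_label (inl (mu t)) q x)
  else (framed q0, initial_labels).

(* Labels live in the fraction field, so being a polynomial is part of the
   assertion that P is the F-polynomial; P is unique (Fpolynomial_unique). *)
Definition is_Fpolynomial (t : nat) (P : {mpoly int[n]}) : Prop :=
  tofrac P = (seed t).2 (inl (mu t)).

Definition Cmatrix (t : nat) : 'M[int]_n :=
  \matrix_(i, j) (((seed t).1 (inr i) (inl j))%:Z
                  - ((seed t).1 (inl j) (inr i))%:Z).

(* A Laurent polynomial is given by its coefficient at each integer exponent
   vector. *)
Definition laurent := 'cV[int]_n -> int.

Definition exponent (m : 'X_{1..n}) : 'cV[int]_n := \col_i (m i)%:Z.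

Definition monomial_subst (M : 'M[int]_n) (P : {mpoly int[n]}) : laurent :=
  fun e => \sum_(m <- msupp P | M *m exponent m == e) P@_m.

(* Since invmx is the identity on non-units, invertibility is required
   explicitly. *)
Definition is_deformed_Fpolynomial (t : nat) (S : laurent) : Prop :=
  exists P : {mpoly int[n]},
    [/\ is_Fpolynomial t P,
        Cmatrix t \in unitmx &
        S = monomial_subst (- invmx (Cmatrix t)) P].

Lemma Fpolynomial_unique t P Q :
  is_Fpolynomial t P -> is_Fpolynomial t Q -> P = Q.
Proof.
by move=> hP hQ; apply/eqP; rewrite -(tofrac_eq P Q); apply/eqP; rewrite hP hQ.
Qed.

Lemma deformed_Fpolynomial_unique t S T :
  is_deformed_Fpolynomial t S -> is_deformed_Fpolynomial t T -> S = T.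
Proof.
by move=> [P [hP _ ->]] [Q [hQ _ ->]]; rewrite (Fpolynomial_unique hP hQ).
Qed.

End FramedSeeds.

Section PowerSeries.
Variable n : nat.
Implicit Types (f g : 'X_{1..n} -> int) (N D : {mpoly int[n]}).

Definition series := 'X_{1..n} -> int.

Definition series_of N : series := fun m => N@_m.

Definition series_add f g : series := fun m => f m + g m.

Definition series_mul f g : series := fun m =>
  \sum_(k : 'X_{1..n < (mdeg m).+1, (mdeg m).+1} | m == (k.1 + k.2)%MM)
    f k.1 * g k.2.

(* Expansion of N / D for D with constant coefficient 1, by the geometric
   series 1 / D = \sum_k (1 - D)^k: the terms with k > mdeg m do not
   contribute to the coefficient of m.  See series_mul_quot. *)
Definition series_quot N D : series := fun m =>
  (N * \sum_(k < (mdeg m).+1) (1 - D) ^+ k)@_m.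

Lemma mcoeff_expr_low D k (m : 'X_{1..n}) :
  D@_0%MM = 0 -> (mdeg m < k)%N -> (D ^+ k)@_m = 0.
Proof.
move=> D0; elim: k m => // k IH m; rewrite ltnS => lek.
rewrite exprS mcoeffM; apply: big1 => -[[a ha] [b hb]] /= /eqP Em.
case: (eqVneq a 0%MM) => [->|an0]; first by rewrite D0 mul0r.
rewrite IH ?mulr0 //; apply: leq_trans lek; rewrite Em mdegD.
by rewrite -addn1 addnC leq_add2r lt0n mdeg_eq0.
Qed.

Lemma mcoeffM_low (p q : {mpoly int[n]}) d (m : 'X_{1..n}) :
  (forall b : 'X_{1..n}, (mdeg b < d)%N -> q@_b = 0) -> (mdeg m < d)%N ->
  (p * q)@_m = 0.
Proof.
move=> hq hm; rewrite mcoeffM; apply: big1 => -[[a ha] [b hb]] /= /eqP Em.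
by rewrite hq ?mulr0 //; apply: leq_ltn_trans hm; rewrite Em mdegD leq_addl.
Qed.

Lemma series_mul_quot N D (m : 'X_{1..n}) :
  D@_0%MM = 1 -> series_mul (series_of D) (series_quot N D) m = N@_m.
Proof.
move=> D1; set d := (mdeg m).+1.
have E0 : (1 - D)@_0%MM = 0 by rewrite mcoeffB mcoeff1 eqxx D1 subrr.
have quotE (b : 'X_{1..n}) : (mdeg b < d)%N ->
    series_quot N D b = (N * \sum_(k < d) (1 - D) ^+ k)@_b.
  move=> hb; rewrite /series_quot -!(big_mkord xpredT (fun k => (1 - D) ^+ k)).
  rewrite [in RHS](big_cat_nat _ hb) //= mulrDr mcoeffD.
  rewrite [X in _ = _ + X](@mcoeffM_low _ _ (mdeg b).+1) ?addr0 //.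
  move=> c hc; rewrite raddf_sum big_nat_cond; apply: big1 => k /andP[/andP[hk _] _].
  by apply: mcoeff_expr_low => //; apply: leq_trans hk.
rewrite /series_mul -/d.
transitivity ((D * (N * \sum_(k < d) (1 - D) ^+ k))@_m).
  rewrite mcoeffM; apply: eq_bigr => -[[a ha] [b hb]] /= _.
  by rewrite /series_of quotE.
have -> : D * (N * \sum_(k < d) (1 - D) ^+ k) = N - N * (1 - D) ^+ d.
  rewrite mulrCA.
  have -> : D * \sum_(k < d) (1 - D) ^+ k = 1 - (1 - D) ^+ d.
    have := subrX1 (1 - D) d; rewrite addrAC subrr sub0r mulNr => /eqP.
    by rewrite eq_sym eqr_oppLR opprB => /eqP.
  by rewrite mulrBr mulr1.
rewrite mcoeffB [X in _ - X](@mcoeffM_low _ _ d) ?subr0 // => b hb.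
exact: mcoeff_expr_low.
Qed.

(* Coefficients of a power series at integer exponents: 0 outside N^n. *)
Definition laurent_of f : laurent n := fun e =>
  if [forall i, 0 <= e i ord0] then f [multinom absz (e i ord0) | i < n] else 0.

(* Every coefficient of S t is eventually constant, equal to that of f, as t
   runs over the residue class of a modulo p. *)
Definition converges_along (p a : nat) (S : nat -> laurent n) f : Prop :=
  forall e : 'cV[int]_n, exists t0 : nat, forall t : nat,
    (t0 <= t)%N -> (t = a %[mod p])%N -> S t e = laurent_of f e.

End PowerSeries.

(* Vertices are numbered from 0, so vertex i of 1, ..., r + 1 is i - 1
   here.  For r = 1 the two summands coincide and give a double arrow. *)
Definition A1r_quiver (r : nat) : quiver 'I_r.+1 :=
  fun i j => ((j == i.+1 :> nat) + ((i == 0%N :> nat) && (j == r :> nat)))%N.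

(* Step t = 1, 2, ... mutates at vertex (t - 1) mod (r + 1). *)
Definition cyclic_sequence (r : nat) : nat -> 'I_r.+1 := fun t => inZp t.-1.

(* 1 + (y_{r+1} + y_{r+1} y_r + ... + y_{r+1} ... y_2) / (1 - y_1 ... y_{r+1})^2
   with indices shifted down by one; y is a cyclic shift of the variables. *)
Definition A1r_limit (r : nat) (y : 'I_r.+1 -> {mpoly int[r.+1]}) :
    series r.+1 :=
  series_add (series_of 1)
    (series_quot (\sum_(i : 'I_r.+1 | (0 < i)%N)
                     \prod_(j : 'I_r.+1 | (i <= j)%N) y j)
                 ((1 - \prod_(j : 'I_r.+1) y j) ^+ 2)).

(* Main.v *)
Require Import Defs.
From mathcomp Require Import all_boot all_order all_algebra.
From mathcomp Require Import zify ring.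

(** Let N = r + 1, and write F_t for the F-polynomial of step t, with F_t = 1
    for t <= 0.

    Every mutation takes place at a source: after it that vertex is a sink, and
    the quiver is the initial one with the vertices rotated by one place.  So
    if vertices are read by their position (the number of steps before their
    next mutation), the quiver of the base vertices never changes, and the
    C-matrix can be followed in closed form ([seedE], [ccol_pred]).  The vertex
    mutated at step t + 1 carries the positive c-vector [cvec t], whose entry
    at i is the quotient of t + r - i by r, the vertices being numbered from 0.
    The exchange relation is
      F_t F_(t-N) = y^(cvec (t-1)) + F_(t-1) F_(t-r).

    Passing from t to t + r adds the vector delta = (1, ..., 1) to the c-vector,
    hence multiplies the inhomogeneous term by Y = y_1 ... y_N.  It follows that
    J = (F_(t+r) + Y F_(t-r)) / F_t does not depend on t.  Its value is
    J = 1 + Y + P, where P is the sum of the r monomials y^(cvec t), t < r.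
    The polynomials are therefore constructed by the linear recurrence
      F_(t+r) = J F_t - Y F_(t-r),
    which shows at once that they are polynomials, and the exchange relation is
    a consequence ([Fpol_exchange]).

    For P = 0 the solution of the recurrence is constantly 1.  The part of F_n
    of first order in the monomials of P is the sum over t < n of
    ((n-1-t) / r + 1) y^(cvec t), with an integer quotient, and what remains has order at least two
    ([Fpol_linear_part]).  The order in P of a monomial is the difference of its
    exponents at the first and the last vertex.

    The deformation is the substitution by - C_n^-1.  It sends cvec (n-1-l) to
    the vector [eta s l], whose entry at a vertex of position p is the quotient
    of l + p by r ([Cm_eta]).  This depends on n only through its residue s
    modulo N, so the first-order part becomes an initial segment of the series
    of terms (l / r + 1) y^(eta s l).  Since eta s (k r + l) = eta s l + k delta,
    that series is the sum of the y^(eta s l), l < r, divided by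
    (1 - Y)^2, which is the announced limit ([laurent_A1r_limit]).
    The terms of higher order disappear: a monomial of order k >= 2 with a given
    image would have exponent about k n / r at the first vertex, whereas the
    exponents in F_n are at most about n / r ([remainder_vanishes]). *)

Set Implicit Arguments.
Unset Strict Implicit.
Unset Printing Implicit Defensive.

Import Order.TTheory GRing.Theory Num.Theory.
Local Open Scope ring_scope.

(** * The F-polynomials and their linear part *)

Section FPolynomials.
Variable r : nat.
Hypothesis hr : (0 < r)%N.
Local Notation pol := {mpoly int[r.+1]}.

Definition delta : 'X_{1..r.+1} := [multinom 1%N | i < r.+1].

(** The c-vector of the vertex mutated at step t + 1. *)
Definition cvec (t : nat) : 'X_{1..r.+1} :=
  [multinom ((t + r - i) %/ r)%N | i < r.+1].

Lemma cvec_addr t : cvec (t + r) = (delta + cvec t)%MM.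
Proof.
apply/mnmP => i; rewrite mnmDE !mnmE.
have hi : (i <= r)%N by rewrite -ltnS.
have -> : (t + r + r - i = 1 * r + (t + r - i))%N by lia.
by rewrite divnMDl.
Qed.

Lemma cvec_max t : cvec t ord_max = (t %/ r)%N.
Proof. by rewrite mnmE /= addnK. Qed.

Lemma cvec_0 t : cvec t ord0 = (t %/ r).+1.
Proof. by rewrite mnmE /= subn0 divnDr ?dvdnn // divnn hr addn1. Qed.

Definition Psum : pol := \sum_(t < r) 'X_[cvec t].
Definition Ymon : pol := 'X_[delta].
Definition Jinv : pol := 1 + Ymon + Psum.

(** The recurrence couples indices that differ by multiples of r, so it is solved
    separately in each residue class i modulo r, q counting the periods. *)
Fixpoint Fres (i q : nat) : pol :=
  match q with
  | 0 => 1
  | q'.+1 =>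
    if q' is q''.+1 then Jinv * Fres i q' - Ymon * Fres i q''
    else 1 + \sum_(t < i) 'X_[cvec t]
  end.

(** Indices are shifted by r, so that the labels 1 present before any mutation
    are included: [Fpol n] is the F-polynomial of step n - r. *)
Definition Fpol (n : nat) : pol := Fres (n %% r) (n %/ r).

Lemma Fpol_rec n : Fpol (n + r + r) = Jinv * Fpol (n + r) - Ymon * Fpol n.
Proof.
by rewrite /Fpol !modnDr !divnDr ?dvdnn // divnn hr !addn1.
Qed.

Lemma Fpol_small n : (n < r)%N -> Fpol n = 1.
Proof. by move=> h; rewrite /Fpol divn_small. Qed.

(** This range includes i = r, one term beyond the initial data: there the
    recurrence yields J - Y = 1 + P, and the period after it starts correctly. *)
Lemma Fpol_init i : (i <= r)%N -> Fpol (i + r) = 1 + \sum_(t < i) 'X_[cvec t].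
Proof.
rewrite leq_eqVlt => /orP[/eqP->|h].
  rewrite -[(r + r)%N]/(0 + r + r)%N Fpol_rec add0n.
  rewrite /Fpol mod0n div0n modnn divnn hr /= big_ord0 addr0 !mulr1 /Jinv /Psum.
  ring.
by rewrite /Fpol modnDr divnDr ?dvdnn // divnn hr modn_small // divn_small.
Qed.

Lemma Fpol_le n : (n <= r)%N -> Fpol n = 1.
Proof.
rewrite leq_eqVlt => /orP[/eqP->|]; last exact: Fpol_small.
by have := @Fpol_init 0 (leq0n r); rewrite add0n big_ord0 addr0.
Qed.

(** By the recurrence, the determinant F_(t+N) F_t - F_(t+1) F_(t+r) is multiplied
    by Y when t increases by r, exactly as y^(cvec t) is; so it is enough to
    compare the two sides in the first period. *)
Lemma Fpol_exchange t :
  Fpol (t + r.+1) * Fpol t = 'X_[cvec t] + Fpol t.+1 * Fpol (t + r).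
Proof.
elim/ltn_ind: t => t IH; case: (ltnP t r) => [lt_tr | le_rt].
  rewrite addnS -addSn (Fpol_init lt_tr) (Fpol_init (ltnW lt_tr)).
  rewrite (Fpol_le lt_tr) (Fpol_le (ltnW lt_tr)).
  by rewrite big_ord_recr /=; ring.
have [s Et] : exists s, t = (s + r)%N by exists (t - r)%N; rewrite subnK.
have lt_st : (s < t)%N by lia.
have {IH lt_st le_rt} := IH s lt_st; rewrite {t}Et.
rewrite !addnS -!addSn !Fpol_rec cvec_addr mpolyXD -/Ymon.
move/eqP; rewrite -subr_eq => /eqP <-.
ring.
Qed.

(** Without this the labels could not be divided by: J evaluates to 1 and Y to 0
    at the origin, so the recurrence preserves the constant term. *)
Lemma Fpol_eval0 n : (Fpol n).@[fun=> 0] = 1.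
Proof.
have X0 (m : 'X_{1..r.+1}) : m ord0 != 0%N -> ('X_[m] : pol).@[fun=> 0] = 0.
  move=> hm; rewrite mevalX (bigD1 ord0) //= expr0n.
  by rewrite (negPf hm) mul0r.
have S0 i : (\sum_(t < i) 'X_[cvec t] : pol).@[fun=> 0] = 0.
  by rewrite raddf_sum /= big1 // => t _; rewrite X0 // cvec_0.
have Y0 : Ymon.@[fun=> 0] = 0 by rewrite X0 // mnmE.
elim/ltn_ind: n => n IH; case: (ltnP n r) => [lt_nr | le_rn].
  by rewrite Fpol_small // rmorph1.
case: (ltnP n (r + r)) => [lt_nrr | le_rrn].
  by rewrite -(subnK le_rn) Fpol_init ?rmorphD /= ?rmorph1 ?S0 ?addr0 //; lia.
have -> : n = (n - r - r + r + r)%N by lia.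
rewrite Fpol_rec rmorphB !rmorphM /= Y0 mul0r subr0 IH; last by lia.
by rewrite mulr1 !rmorphD /= Y0 S0 rmorph1 !addr0.
Qed.

Lemma Fpol_neq0 n : Fpol n != 0.
Proof. by apply: contra_eqN (Fpol_eval0 n) => /eqP->; rewrite rmorph0. Qed.

(** The first-order part in P of the F-polynomial of step n. *)
Definition Lin (n : nat) : pol :=
  \sum_(t < n) 'X_[cvec t] *+ ((n - t.+1) %/ r).+1.

Lemma Lin_addr n :
  Lin (r + n) =
  \sum_(t < r) 'X_[cvec t] *+ ((r + n - t.+1) %/ r).+1 + Ymon * Lin n.
Proof.
rewrite /Lin big_split_ord mulr_sumr /=; congr (_ + _).
apply: eq_bigr => t _; rewrite addnC cvec_addr mpolyXD -mulrnAr.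
by congr (_ * (_ *+ (_ %/ r).+1)); lia.
Qed.

(** This is the recurrence of [Fpol] linearised at P = 0: there J is 1 + Y and the
    solution is 1, whence the source term P. *)
Lemma Lin_rec n : Lin (n + r) = Lin n + Ymon * (Lin n - Lin (n - r)) + Psum.
Proof.
rewrite addnC Lin_addr.
suff E : \sum_(t < r) 'X_[cvec t] *+ ((r + n - t.+1) %/ r).+1
    = Lin n - Ymon * Lin (n - r) + Psum by rewrite E; ring.
case: (ltnP n r) => [lt_nr|le_rn].
  have -> : (n - r = 0)%N by lia.
  rewrite {2}/Lin big_ord0 mulr0 subr0.
  rewrite /Lin (big_ord_widen _ (fun t => 'X_[cvec t] *+ ((n - t.+1) %/ r).+1)
     (ltnW lt_nr)) [in RHS]big_mkcond /Psum -big_split; apply: eq_bigr => t _ /=.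
  case: ltnP => htn.
    have -> : (r + n - t.+1 = 1 * r + (n - t.+1))%N by lia.
    by rewrite divnMDl // divn_small -?mulrSr //; lia.
  by rewrite divn_small ?add0r ?mulr1n //; lia.
have En : n = (r + (n - r))%N by lia.
rewrite {2}En Lin_addr addrK /Psum -big_split; apply: eq_bigr => t _ /=.
have ht := ltn_ord t; rewrite -En -mulrSr.
have -> : (r + n - t.+1 = 1 * r + (n - t.+1))%N by lia.
by rewrite divnMDl.
Qed.

(** Every monomial of P, cvec t with t < r, has exponent 1 at the first vertex
    and 0 at the last, while Y has 1 at both; so m ord0 - m ord_max is the order
    in P of a monomial m, and d bounds it from below.  The bound on
    m ord0 is scaled by r, so that it grows by r over a period. *)
Definition supported (d b : nat) (P : pol) :=
  forall m, P@_m != 0 -> (m ord_max + d <= m ord0)%N /\ (r * m ord0 <= b)%N.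

Lemma supported_weaken d b d' b' P : (d' <= d)%N -> (b <= b')%N ->
  supported d b P -> supported d' b' P.
Proof. by move=> hd hb hP m /hP[h1 h2]; split; lia. Qed.

Lemma supported0 d b : supported d b 0.
Proof. by move=> m; rewrite mcoeff0 eqxx. Qed.

Lemma supportedD d b P Q :
  supported d b P -> supported d b Q -> supported d b (P + Q).
Proof.
move=> hP hQ m; rewrite mcoeffD; have [->|/hP//] := eqVneq P@_m 0.
by rewrite add0r => /hQ.
Qed.

Lemma supportedN d b P : supported d b P -> supported d b (- P).
Proof. by move=> hP m; rewrite mcoeffN oppr_eq0 => /hP. Qed.

Lemma supportedM d b d' b' P Q : supported d b P -> supported d' b' Q ->
  supported (d + d') (b + b') (P * Q).
Proof.
move=> hP hQ m; rewrite -mcoeff_msupp => /msuppM_le /allpairsP[[m1 m2] /=].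
rewrite !mcoeff_msupp => -[/hP[h1 h2] /hQ[h3 h4] ->].
by rewrite !mnmDE; split; nia.
Qed.

Lemma supportedXn d b (m : 'X_{1..r.+1}) k :
  (m ord_max + d <= m ord0)%N -> (r * m ord0 <= b)%N ->
  supported d b ('X_[m] *+ k).
Proof.
move=> h1 h2 m'; rewrite mcoeffMn mcoeffX.
by have [<-|] := eqVneq m m'; rewrite // mul0rn eqxx.
Qed.

Lemma supported_sumX d b n (c : 'I_n -> nat) :
  (d <= 1)%N -> (forall t : 'I_n, r * (t %/ r).+1 <= b)%N ->
  supported d b (\sum_(t < n) 'X_[cvec t] *+ c t).
Proof.
move=> hd hb; elim/big_ind: _ => [|P Q|t _].
- exact: supported0.
- exact: supportedD.
apply: supportedXn; rewrite ?cvec_max cvec_0 ?hb //; lia.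
Qed.

(** The error satisfies the same linear recurrence with source term P * Lin, which
    is of order two, and it vanishes during the first two periods. *)
Lemma Fpol_linear_part n : supported 2 n (Fpol n - 1 - Lin (n - r)).
Proof.
elim/ltn_ind: n => n IH; case: (leqP n (r + r)) => [le_nrr | lt_rrn].
  suff -> : Fpol n - 1 - Lin (n - r) = 0 by exact: supported0.
  case: (leqP n r) => [le_nr | lt_rn].
    have -> : (n - r = 0)%N by lia.
    by rewrite Fpol_le // /Lin big_ord0; ring.
  rewrite -{1}(subnK (ltnW lt_rn)) Fpol_init; last by lia.
  rewrite [1 + _]addrC addrK; apply/eqP; rewrite subr_eq0; apply/eqP.
  by apply: eq_bigr => t _; rewrite divn_small ?mulr1n //; lia.
have [k En] : exists k, n = (k + r + r)%N by exists (n - r - r)%N; lia.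
rewrite {n}En in IH lt_rrn *; rewrite addnK Lin_rec Fpol_rec.
have := IH (k + r)%N ltac:(lia); have := IH k ltac:(lia).
rewrite addnK; set R0 := Fpol k - _ - _; set R1 := Fpol (k + r) - _ - _.
move=> h0 h1.
have -> : Jinv * Fpol (k + r) - Ymon * Fpol k - 1 -
    (Lin k + Ymon * (Lin k - Lin (k - r)) + Psum) =
    Psum * Lin k + Jinv * R1 - Ymon * R0.
  by rewrite /R0 /R1 /Jinv; ring.
have hP d : (d <= 1)%N -> supported d r Psum.
  move=> hd; rewrite /Psum (eq_bigr (fun t : 'I_r => 'X_[cvec t] *+ 1)) //.
  by apply: supported_sumX => // t; rewrite divn_small ?muln1.
have hL : supported 1 (k + r) (Lin k).
  apply: supported_sumX => // t.
  have := leq_trunc_div t r; have := ltn_ord t; nia.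
have hY : supported 0 r Ymon.
  by rewrite -[Ymon]mulr1n; apply: supportedXn; rewrite !mnmE; lia.
have hJ : supported 0 r Jinv.
  apply: supportedD; last exact: hP.
  apply: supportedD; last by [].
  rewrite -mpolyX0 -['X_[_]]mulr1n; apply: supportedXn; rewrite !mnm0E; lia.
apply: supportedD; first apply: supportedD.
- by apply: supported_weaken (supportedM (hP 1%N _) hL); lia.
- by apply: supported_weaken (supportedM hJ h1); lia.
- by apply/supportedN/(supported_weaken _ _ (supportedM hY h0)); lia.
Qed.
End FPolynomials.

(** * Mutation of the framed quiver *)

Definition pospart (z : int) : nat := if z is Posz n then n else 0%N.

Lemma pospart_sub (a b : nat) : pospart (a%:Z - b%:Z) = (a - b)%N.
Proof.
case: (leqP b a) => h; first by rewrite subzn.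
have -> : a%:Z - b%:Z = Negz (b - a).-1 by lia.
by rewrite /=; lia.
Qed.

Lemma pospart_decomp (z : int) : z = (pospart z)%:Z - (pospart (- z))%:Z.
Proof. by case: z => [[|n]|n] //=; lia. Qed.

(** No path through k starts or ends at k, so the arrows at k are only reversed. *)
Lemma mutate_at (V : finType) (k : V) (q : quiver V) i j : q k k = 0%N ->
  (i == k) || (j == k) -> mutate k q i j = (q j i - q i j)%N.
Proof.
move=> qkk h; rewrite /mutate /delete_2cycles /reverse_at /add_paths h orbC h.
by case/orP: h => /eqP->; rewrite qkk ?muln0 ?mul0n !addn0.
Qed.

Lemma mutate_away (V : finType) (k : V) (q : quiver V) i j :
  i != k -> j != k ->
  mutate k q i j = (q i j + q i k * q k j - (q j i + q j k * q k i))%N.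
Proof.
move=> /negPf hi /negPf hj.
by rewrite /mutate /delete_2cycles /reverse_at /add_paths hi hj.
Qed.

Section Seeds.
Variable r : nat.
Hypothesis hr : (0 < r)%N.
Local Notation V := ('I_r.+1 + 'I_r.+1)%type.

(** The number of further mutations before v is mutated, when t have been made. *)
Definition pos (t : nat) (v : 'I_r.+1) : 'I_r.+1 := v - inZp t.

Lemma pos0 v : pos 0 v = v.
Proof. by rewrite /pos (_ : inZp 0 = 0) ?subr0 //; apply/val_inj. Qed.

Lemma pos_mut t : pos t (inZp t) = ord0.
Proof. by rewrite /pos subrr; apply/val_inj. Qed.

Lemma pos_eq0 t v : (pos t v == 0%N :> nat) = (v == inZp t).
Proof. by rewrite -[RHS]subr_eq0 -[RHS](inj_eq val_inj). Qed.

Lemma pos_succ t v :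
  pos t.+1 v = (if pos t v == 0%N :> nat then r else (pos t v).-1) :> nat.
Proof.
have -> : pos t.+1 v = pos t v - inZp 1.
  rewrite /pos -addrA -opprD; congr (_ - _); apply/val_inj => /=.
  by rewrite modnDm addn1.
case: (pos t v) => p hp /=.
rewrite (@modn_small 1) // subSS subn0 (@modn_small r) //.
case: p hp => [|p] hp /=; first by rewrite modn_small.
by rewrite addSnnS modnDr modn_small // ltnW.
Qed.

Lemma big_pos (R : Type) (idx : R) (op : Monoid.com_law idx) t (F : 'I_r.+1 -> R) :
  \big[op/idx]_v F (pos t v) = \big[op/idx]_p F p.
Proof.
rewrite (reindex_inj (addIr (inZp t))) /=.
by apply: eq_bigr => p _; rewrite /pos addrK.
Qed.

(** The initial quiver on positions.  It is a quiver on natural numbers, so that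
    positions can be shifted without bounds to carry along. *)
Definition arr (p p' : nat) : nat := (p' == p.+1) + ((p == 0%N) && (p' == r)).

Lemma arrp0 p : arr p 0 = 0%N.
Proof. by rewrite /arr; lia. Qed.

Lemma arr_ge p p' : (p' <= p)%N -> arr p p' = 0%N.
Proof.
move=> le_p'p; rewrite /arr ltn_eqF ?ltnS //=.
by case: p le_p'p => [|//]; rewrite leqn0 => /eqP-> /=; rewrite ltn_eqF.
Qed.

Lemma arr_sub p p' : (arr p p' - arr p' p)%N = arr p p'.
Proof.
case/orP: (leq_total p p') => h; last by rewrite (arr_ge h).
by rewrite (arr_ge h) subn0.
Qed.

(** One mutation lowers each position by one and sends position 0 to r.  Read on
    positions, reversing the arrows at the source gives back the same quiver. *)
Lemma arr_pred p p' : (p <= r)%N -> (p' <= r)%N ->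
  arr (if p == 0%N then r else p.-1) (if p' == 0%N then r else p'.-1) =
  (if (p == 0%N) || (p' == 0%N) then arr p' p - arr p p' else arr p p')%N.
Proof.
have r0 : (r == 0%N) = false by rewrite gtn_eqF.
case: p p' => [|p] [|p'] hp hp' /=; rewrite ?arrp0 ?subn0 /arr ?eqxx ?r0 /=.
- by rewrite ltn_eqF.
- by rewrite addn0 ltn_eqF // ltnW // ltnS.
- by rewrite andbT addnC eqSS eq_sym [p.+1 == r]eq_sym addnC.
- by rewrite eqSS (ltn_eqF hp') andbF.
Qed.

Lemma big_arr0 (K : comNzRingType) (a : nat -> K) :
  \prod_(p < r.+1) a p ^+ arr 0 p = a 1%N * a r.
Proof.
have one c : (c <= r)%N -> \prod_(p < r.+1) a p ^+ (p == c :> nat) = a c.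
  move=> hc; have lt_cr : (c < r.+1)%N by [].
  rewrite (bigD1 (Ordinal lt_cr)) //= eqxx expr1 big1 ?mulr1 // => p.
  by rewrite -val_eqE /= => /negPf->.
rewrite /arr eqxx; under eq_bigr do rewrite exprD.
by rewrite big_split !one.
Qed.

(** The c-vector mutated at step t, continued to t = 0 in such a way that the
    increments are still given by [hstep]: [gcol 0] is -1 at the last vertex. *)
Definition gcol (t i : nat) : int := ((t + r + r - i.+1) %/ r)%:Z - 1.
(** Whether the c-vectors of two consecutive steps differ at i: a quotient by r
    grows by one exactly at the multiples of r.  This is periodic in s. *)
Definition hstep (s i : nat) : bool := (r %| s + r - i)%N.

(** The column of the C-matrix at a vertex of position p.  At p = r, just after
    its mutation, it is - gcol t; later, for 0 < p < r, it is the difference of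
    two consecutive c-vectors; at p = 0 it is the next c-vector.  The same formula
    covers the vertices that have not been mutated yet. *)
Definition ccol (t p i : nat) : int :=
  gcol t i * ((p == 0%N)%:Z - (p == r)%:Z)
  + (p < r)%N%:Z * (hstep (t + p) i)%:Z.

Lemma gcolS t (i : 'I_r.+1) : gcol t.+1 i = (cvec r t i)%:Z.
Proof.
have hi := ltn_ord i; rewrite /gcol mnmE.
have -> : (t.+1 + r + r - i.+1 = 1 * r + (t + r - i))%N by lia.
by rewrite divnMDl //; lia.
Qed.

Lemma gcol_hstep t i : (i <= r)%N -> gcol t.+1 i = gcol t i + (hstep t i)%:Z.
Proof.
move=> hi; rewrite /gcol /hstep.
have -> : (t.+1 + r + r - i.+1 = (t + r + r - i.+1).+1)%N by lia.
rewrite divnS //.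
have -> : ((t + r + r - i.+1).+1 = t + r - i + r)%N by lia.
by rewrite dvdn_addl //; lia.
Qed.

Lemma hstep_addr s i : (i <= r)%N -> hstep (s + r) i = hstep s i.
Proof.
move=> hi; rewrite /hstep; have -> : (s + r + r - i = s + r - i + r)%N by lia.
by rewrite dvdn_addl.
Qed.

Lemma ccol0 t (i : 'I_r.+1) : ccol t 0 i = (cvec r t i)%:Z.
Proof.
rewrite -gcolS gcol_hstep -1?ltnS // /ccol addn0 eqxx hr (ltn_eqF hr).
by rewrite subr0 mulr1 mul1r.
Qed.

Lemma ccol_last t (i : 'I_r.+1) : ccol t.+1 r i = - ccol t 0 i.
Proof. by rewrite ccol0 -gcolS /ccol ltnn eqxx; nia. Qed.

(** The C-matrix mutates by adding to each column the mutated c-vector as often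
    as there are arrows from the mutated source. *)
Lemma ccol_pred t p (i : 'I_r.+1) : (0 < p <= r)%N ->
  ccol t.+1 p.-1 i = ccol t p i + ccol t 0 i * (arr 0 p)%:Z.
Proof.
have hi : (i <= r)%N by rewrite -ltnS.
case: p => [//|p] /andP[_ hp] /=.
rewrite ccol0 -gcolS /ccol /arr hp addSnnS (gcol_hstep _ hi) /=.
have [Ep|ne_pr] := eqVneq p.+1 r; last by move: hp ne_pr; nia.
rewrite Ep (hstep_addr _ hi) ltnn; nia.
Qed.

Lemma ccol_init p (i : 'I_r.+1) : (p <= r)%N -> ccol 0 p i = (p == i :> nat)%:Z.
Proof.
have hi : (i <= r)%N by rewrite -ltnS.
move=> hp; have [->|p0] := posnP p.
  rewrite ccol0 mnmE add0n; have [->|i0] := posnP i.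
    by rewrite subn0 divnn hr.
  by rewrite divn_small; lia.
move: hp; rewrite leq_eqVlt => /orP[/eqP->|lt_pr].
  rewrite /ccol ltnn eqxx /gcol add0n; rewrite (gtn_eqF hr).
  have [Eri|ne] := eqVneq r i; first by rewrite divn_small; lia.
  have -> : (r + r - i.+1 = 1 * r + (r - i.+1))%N by lia.
  by rewrite divnMDl // divn_small; lia.
rewrite /ccol lt_pr /hstep add0n.
have -> : (r %| p + r - i)%N = (p == i).
  apply/idP/eqP => [/dvdnP[k Ek]|->]; last by rewrite addnC addnK.
  have k1 : k = 1%N by nia.
  by lia.
by rewrite (gtn_eqF p0) (ltn_eqF lt_pr) subrr mulr0 add0r mul1r.
Qed.

Notation q0 := (@A1r_quiver r).
Notation mu := (@cyclic_sequence r).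

(** A vertex of position p was last mutated at step t + p - r, and its label is
    the F-polynomial of that step; the shift in [Fpol] turns this into t + p. *)
Definition seed_spec t (q : quiver V) (x : labels r.+1) : Prop :=
  [/\ forall u v, q (inl u) (inl v) = arr (pos t u) (pos t v),
      forall i v, q (inr i) (inl v) = pospart (ccol t (pos t v) i),
      forall i v, q (inl v) (inr i) = pospart (- ccol t (pos t v) i),
      forall v, x (inl v) = tofrac (Fpol r (t + pos t v))
    & forall i, x (inr i) = tofrac ('X_i : {mpoly int[r.+1]})].

Lemma seedE t : seed_spec t (seed q0 mu t).1 (seed q0 mu t).2.
Proof.
elim: t => [|t].
  split=> //; [move=> u v | move=> i v | move=> i v | move=> v]; rewrite [LHS]/=.
  - by rewrite !pos0.
  - by rewrite ccol_init ?pos0 -1?ltnS // eq_sym.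
  - by rewrite ccol_init ?pos0 -1?ltnS //; case: eqP.
  - by rewrite add0n Fpol_le ?rmorph1 // -ltnS ltn_ord.
set k : 'I_r.+1 := inZp t.
have -> : seed q0 mu t.+1 = (mutate (inl k) (seed q0 mu t).1,
    mutate_label (inl k) (seed q0 mu t).1 (seed q0 mu t).2).
  by rewrite /=; case: (seed q0 mu t).
move=> IH; case: (seed _ _ t) IH => q x.
rewrite -[(q, x).1]/q -[(q, x).2]/x => -[Eqb Eqf Eqf' Exb Exf].
rewrite -[(_, _).1]/(mutate (inl k) q) -[(_, _).2]/(mutate_label (inl k) q x).
have qkk : q (inl k) (inl k) = 0%N by rewrite Eqb pos_mut arrp0.
have inlE (v : 'I_r.+1) : (inl v == inl k :> V) = (pos t v == 0%N :> nat).
  by rewrite pos_eq0.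
have inrE (v : 'I_r.+1) : (inr v == inl k :> V) = false by [].
have hk (i : 'I_r.+1) : ccol t (pos t k) i = (cvec r t i)%:Z by rewrite pos_mut ccol0.
split.
- move=> u v; rewrite !pos_succ arr_pred ?leq_ord // -!inlE.
  case: ifP => [h|/negbT/norP[hu hv]].
    by rewrite (mutate_at qkk h) !Eqb.
  by rewrite (mutate_away _ hu hv) !Eqb pos_mut !arrp0 !mul0n !addn0 arr_sub.
- move=> i v; case: (boolP (inl v == inl k :> V)) => h.
    rewrite (mutate_at qkk) ?h ?orbT // pos_succ -inlE h ccol_last Eqf Eqf'.
    by move: h; rewrite inlE => /eqP->; rewrite ccol0; case: (cvec r t i).
  rewrite mutate_away // !Eqb pos_mut arrp0 mul0n addn0 !Eqf Eqf' hk
    [nat_of_ord ord0]/= -[pospart (cvec _ _ _)%:Z]/(cvec r t i : nat).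
  rewrite -pospart_sub pos_succ -inlE (negPf h) ccol_pred ?ccol0; last first.
    by rewrite leq_ord andbT lt0n -inlE.
  by congr pospart; rewrite [X in _ = X + _]pospart_decomp; lia.
- move=> i v; case: (boolP (inl v == inl k :> V)) => h.
    rewrite (mutate_at qkk) ?h // pos_succ -inlE h ccol_last Eqf Eqf' opprK.
    by move: h; rewrite inlE => /eqP->; rewrite ccol0; case: (cvec r t i).
  rewrite mutate_away // !Eqb pos_mut arrp0 mul0n addn0 !Eqf Eqf' hk
    [nat_of_ord ord0]/= -[pospart (cvec _ _ _)%:Z]/(cvec r t i : nat).
  rewrite -pospart_sub pos_succ -inlE (negPf h) ccol_pred ?ccol0; last first.
    by rewrite leq_ord andbT lt0n -inlE.
  by congr pospart; rewrite [X in _ = - (X + _)]pospart_decomp; lia.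
- move=> v; rewrite /mutate_label inlE pos_succ; case: ifP => [_|/negbT h].
    have F0 : tofrac (Fpol r t) != 0 by rewrite tofrac_eq0 Fpol_neq0.
    rewrite !big_sumType /= Exb pos_mut addn0.
    apply: (mulIf F0); rewrite divfK // addSnnS -tofracM (Fpol_exchange hr).
    rewrite tofracD tofracM; congr (_ + _).
      rewrite big1 ?mul1r; last by move=> u _; rewrite Eqb pos_mut arrp0 expr0.
      rewrite mpolyXE_id rmorph_prod; apply: eq_bigr => i _.
      by rewrite Exf Eqf hk rmorphXn.
    rewrite [X in _ * X]big1 ?mulr1; last first.
      by move=> i _; rewrite Eqf' hk; case: (cvec r t i) => *; rewrite expr0.
    have := big_arr0 (fun p => tofrac (Fpol r (t + p))); rewrite addn1 => <-.
    rewrite -(big_pos _ t (fun p : 'I_r.+1 => tofrac (Fpol r (t + p)) ^+ arr 0 p)).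
    by apply: eq_bigr => u _; rewrite Exb Eqb pos_mut.
  by rewrite Exb addSnnS prednK // lt0n.
- by move=> i; rewrite /mutate_label inrE Exf.
Qed.
End Seeds.

(** * Coefficients after deformation *)

Section Laurent.
Variable n : nat.

Lemma exponentK (m : 'X_{1..n}) : [multinom absz (exponent m i ord0) | i < n] = m.
Proof. by apply/mnmP => i; rewrite mnmE mxE. Qed.

Lemma exponent_inj : injective (@exponent n).
Proof. by move=> m m' E; rewrite -[m]exponentK E exponentK. Qed.

Lemma exponent0 : exponent (0%MM : 'X_{1..n}) = 0.
Proof. by apply/matrixP => i j; rewrite !mxE mnm0E. Qed.

Lemma exponent_ge0 (m : 'X_{1..n}) : [forall i, 0 <= exponent m i ord0].
Proof. by apply/forallP => i; rewrite mxE. Qed.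

Lemma exponent_absz (u : 'cV[int]_n) : [forall i, 0 <= u i ord0] ->
  exponent [multinom absz (u i ord0) | i < n] = u.
Proof.
move=> /forallP hu; apply/matrixP => i j; rewrite !mxE mnmE (ord1 j).
exact: gez0_abs (hu i).
Qed.

Lemma laurent_ofD (P Q : {mpoly int[n]}) u :
  laurent_of (series_of (P + Q)) u =
  laurent_of (series_of P) u + laurent_of (series_of Q) u.
Proof.
by rewrite /laurent_of /series_of; case: ifP => _; rewrite ?addr0 ?mcoeffD.
Qed.

Lemma laurent_of_sum (I : finType) (F : I -> {mpoly int[n]}) u :
  laurent_of (series_of (\sum_i F i)) u =
  \sum_i laurent_of (series_of (F i)) u.
Proof.
rewrite /laurent_of /series_of; case: ifP => _; last by rewrite big1.
by rewrite raddf_sum.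
Qed.

Lemma laurent_ofX (m : 'X_{1..n}) k u :
  laurent_of (series_of ('X_[m] *+ k)) u = (u == exponent m)%:R *+ k.
Proof.
rewrite /laurent_of /series_of mcoeffMn mcoeffX.
case: ifP => hu; first by rewrite -(inj_eq exponent_inj) exponent_absz // eq_sym.
by case: eqP hu => [->|_ _]; rewrite ?exponent_ge0 // mul0rn.
Qed.

Lemma laurent_of_neq0 (P : {mpoly int[n]}) u :
  laurent_of (series_of P) u != 0 -> exists2 m, u = exponent m & P@_m != 0.
Proof.
rewrite /laurent_of /series_of; case: ifP => [hu hP|]; last by rewrite eqxx.
by exists [multinom absz (u i ord0) | i < n]; rewrite ?exponent_absz.
Qed.

(** A monomial y^m of P contributes at e when - C^-1 m = e, that is, m = - C e;
    hence at most one monomial contributes. *)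
Lemma monomial_subst_inv (C : 'M[int]_n) (P : {mpoly int[n]}) e : C \in unitmx ->
  monomial_subst (- invmx C) P e = laurent_of (series_of P) (- (C *m e)).
Proof.
move=> uC; set u := - (C *m e).
have eqE m : (- invmx C *m exponent m == e) = (exponent m == u).
  apply/eqP/eqP => [E|->]; rewrite /u.
    by rewrite -E mulmxA mulmxN mulmxV // mulNmx mul1mx opprK.
  by rewrite mulNmx mulmxN opprK mulKmx.
rewrite /monomial_subst (eq_bigl _ _ eqE) /laurent_of /series_of.
case: ifP => hu.
  set m0 := [multinom _ | _ < _]; have E0 : exponent m0 = u := exponent_absz hu.
  have eqE' m : (exponent m == u) = (m == m0) by rewrite -E0 (inj_eq exponent_inj).
  rewrite (eq_bigl _ _ eqE').
  have [hm|hm] := boolP (m0 \in msupp P).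
    by rewrite -big_filter filter_pred1_uniq // big_seq1.
  move: hm; rewrite -mcoeff_eq0 => /eqP P0.
  by rewrite big1 // => m /eqP->.
by rewrite big1 // => m /eqP E; rewrite -E exponent_ge0 in hu.
Qed.
End Laurent.

Section CMatrix.
Variable r : nat.
Hypothesis hr : (0 < r)%N.
Notation q0 := (@A1r_quiver r).
Notation mu := (@cyclic_sequence r).

Definition Cm (t : nat) : 'M[int]_r.+1 := \matrix_(i, v) ccol r t (pos t v) i.

Lemma Cmatrix_Cm t : Cmatrix q0 mu t = Cm t.
Proof.
have [_ Ef Ef' _ _] := seedE hr t.
by apply/matrixP => i v; rewrite !mxE Ef Ef' -pospart_decomp.
Qed.

(** Mutation multiplies the C-matrix by the matrix E, which differs from the
    identity only in the row of the mutated source.  Its diagonal entry there is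
    -1, so E is an involution. *)
Lemma Cm_unit t : Cm t \in unitmx.
Proof.
elim: t => [|t IH].
  suff -> : Cm 0 = 1%:M by exact: unitmx1.
  by apply/matrixP => i v; rewrite !mxE pos0 ccol_init ?leq_ord // natz eq_sym.
pose k : 'I_r.+1 := inZp t.
pose w : 'rV[int]_r.+1 :=
  \row_v (if pos t v == 0%N :> nat then -2 else (arr r 0 (pos t v))%:Z).
pose E := 1%:M + delta_mx k (0 : 'I_1) *m w.
have uE : E \in unitmx.
  suff : E *m E = 1%:M by case/mulmx1_unit.
  have wk : w *m delta_mx k 0 = (-2)%:M.
    rewrite -colE; apply/matrixP => i j; rewrite !mxE pos_mut /= !ord1 eqxx.
    by rewrite mulr1n.
  rewrite /E mulmxDl mul1mx mulmxDr mulmx1 -mulmxA (mulmxA w) wk.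
  rewrite mul_scalar_mx -scalemxAr.
  move: (delta_mx _ _ *m w) => D.
  by rewrite scaleNr scaler_nat mulr2n opprD addNKr addrK.
suff -> : Cm t.+1 = Cm t *m E by rewrite unitmx_mul IH.
rewrite /E mulmxDr mulmx1 mulmxA -colE.
apply/matrixP => i v; rewrite !mxE big_ord1 !mxE pos_succ // pos_mut [nat_of_ord ord0]/=.
case: eqP => [->|/eqP h]; first by rewrite ccol_last //; lia.
by rewrite ccol_pred // leq_ord lt0n h.
Qed.

(** In closed form the columns involve only [gcol t], with opposite signs at the
    positions 0 and r, and the [hstep] indicators at the positions below r. *)
Lemma Cm_mul t (w : 'cV[int]_r.+1) (W : nat -> int) (i : 'I_r.+1) :
  (forall v, w v 0 = W (pos t v)) ->
  (Cm t *m w) i 0 = gcol r t i * (W 0%N - W r)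
                    + \sum_(p < r) W p * (hstep r (t + p) i)%:Z.
Proof.
move=> hw; rewrite mxE.
under eq_bigr do rewrite mxE hw.
rewrite (big_pos _ t (fun p : 'I_r.+1 => ccol r t p i * W p)) /=.
under eq_bigr do rewrite /ccol mulrDl.
rewrite big_split /=; congr (_ + _).
  case: r hr i w hw => // r' _ i w hw.
  rewrite big_ord_recl big_ord_recr /= big1 => [|j _].
    by rewrite /bump /= add1n eqxx; lia.
  by rewrite /bump /= add1n eqSS ltn_eqF // subrr mulr0 mul0r.
rewrite big_ord_recr /= ltnn !mul0r addr0; apply: eq_bigr => p _.
by rewrite ltn_ord mul1r mulrC.
Qed.

(** The image under the deformation of the c-vector mutated l steps before the
    last mutated one; s is the vertex of position 0. *)
Definition eta (s : 'I_r.+1) (l : nat) : 'X_{1..r.+1} :=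
  [multinom ((l + (v - s)%R) %/ r)%N | v < r.+1].

Lemma hstep_addMr k s i : (i <= r)%N -> hstep r (s + k * r) i = hstep r s i.
Proof.
move=> hi; elim: k => [|k IH]; first by rewrite addn0.
by rewrite mulSn addnCA addnC hstep_addr // addnC.
Qed.

(** When l increases, the quotient of l + p grows at the only p < r for which r
    divides l + p + 1.  At that p the periodic indicator is the increment of
    [gcol] from step n - l - 1 to step n - l, so the sum telescopes. *)
Lemma sum_hstep n l (i : 'I_r.+1) : (l <= n)%N ->
  \sum_(p < r) ((l + p) %/ r)%:Z * (hstep r (n + p) i)%:Z
  = gcol r n i - gcol r (n - l) i.
Proof.
have hi : (i <= r)%N := leq_ord i.
elim: l => [|l IH] hl.
  by rewrite subn0 subrr big1 // => p _; rewrite add0n divn_small // mul0r.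
have -> : gcol r (n - l.+1) i = gcol r (n - l) i - (hstep r (n - l.+1) i)%:Z.
  by rewrite -(subnSK hl) gcol_hstep // addrK.
rewrite opprB addrCA -{}IH ?(ltnW hl) //.
under eq_bigr do rewrite addSn divnS // PoszD mulrDl.
rewrite big_split /= ; congr (_ + _).
(* The position below r at which the quotient of l + p by r grows. *)
have lt_p0 : (r.-1 - l %% r < r)%N by lia.
have hl' := divn_eq l r; have hm := ltn_pmod l hr.
rewrite (bigD1 (Ordinal lt_p0)) //= big1 ?addr0 => [|p].
  have -> : ((l + (r.-1 - l %% r)).+1 = (l %/ r).+1 * r)%N by lia.
  rewrite dvdn_mull // mul1r.
  by rewrite -(hstep_addMr (l %/ r).+1 (n - l.+1) hi); congr (hstep _ _ _)%:Z; lia.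
rewrite -val_eqE /= => ne; have hp := ltn_ord p.
case: dvdnP => [[k Ek]|]; last by rewrite mul0r.
have : k = (l %/ r).+1 by nia.
by move=> ?; exfalso; move/eqP: ne; apply; subst k; lia.
Qed.

Lemma Cm_eta n l : (l < n)%N ->
  Cm n *m exponent (eta (inZp n) l) = - exponent (cvec r (n - l.+1)).
Proof.
move=> hl; apply/matrixP => i j; rewrite ord1 {j}.
rewrite (Cm_mul (W := fun p => ((l + p) %/ r)%:Z)); last first.
  by move=> v; rewrite mxE mnmE.
rewrite sum_hstep 1?ltnW // !mxE addn0 divnDr // divnn hr -gcolS // subnSK //.
lia.
Qed.
End CMatrix.

(** * The limit *)

Lemma geometric_square (K : comNzRingType) (y : K) d :
  (1 - y) ^+ 2 * \sum_(k < d) y ^+ k *+ k.+1 =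
  1 - y ^+ d * (d.+1%:R - d%:R * y).
Proof.
elim: d => [|d IH]; first by rewrite big_ord0 expr0 mulr0 mul0r subr0 mulr1 subrr.
rewrite big_ord_recr mulrDr IH /= -[_ *+ d.+1]mulr_natr [y ^+ d.+1]exprS.
by rewrite -[d.+2%:R]natr1 -[d.+1%:R]natr1; ring.
Qed.

(** The expansion of 1 / D is truncated at the degree of m, and so is the sum of
    the (k + 1) Y^k.  Modulo Y^d both are inverses of (1 - Y)^2. *)
Lemma series_quot_square n (N Y : {mpoly int[n]}) (m : 'X_{1..n}) :
  Y@_0%MM = 0 ->
  series_quot N ((1 - Y) ^+ 2) m =
  (N * \sum_(k < (mdeg m).+1) Y ^+ k *+ k.+1)@_m.
Proof.
move=> Y0; rewrite /series_quot; set d := (mdeg m).+1.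
set D := (1 - Y) ^+ 2; set G := \sum_(k < d) (1 - D) ^+ k.
set W := \sum_(k < d) _.
have DW : D * W = 1 - Y ^+ d * (d.+1%:R - d%:R * Y) by exact: geometric_square.
have DG : D * G = 1 - (1 - D) ^+ d.
  have /eqP := subrX1 (1 - D) d; rewrite -/G addrAC subrr sub0r mulNr.
  by rewrite eq_sym eqr_oppLR opprB => /eqP.
have ED : 1 - D = Y * (2%:R - Y) by rewrite /D; ring.
(* Up to a multiple of Y^d the sums G and W agree: compute D G W in two ways. *)
have -> : N * G = N * W
    + N * (G * (d.+1%:R - d%:R * Y) - (2%:R - Y) ^+ d * W) * Y ^+ d.
  have -> : N * G = N * (G * (D * W + Y ^+ d * (d.+1%:R - d%:R * Y))).
    by rewrite DW; ring.
  have -> : G * (D * W + Y ^+ d * (d.+1%:R - d%:R * Y)) =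
     D * G * W + G * Y ^+ d * (d.+1%:R - d%:R * Y) by ring.
  rewrite DG ED exprMn_comm; last exact: mulrC.
  ring.
rewrite mcoeffD [X in _ + X](@mcoeffM_low _ _ _ d) ?addr0 // => b hb.
exact: mcoeff_expr_low.
Qed.

Section Limit.
Variable r : nat.
Hypothesis hr : (0 < r)%N.
Variable s : 'I_r.+1.
Local Notation y := (fun j : 'I_r.+1 => 'X_(j + s) : {mpoly int[r.+1]}).

Lemma prod_shift (Q : pred 'I_r.+1) :
  \prod_(j | Q j) y j = 'X_[[multinom nat_of_bool (Q (v - s)%R) | v < r.+1]].
Proof.
rewrite mpolyXE_id [RHS](reindex_inj (addIr s)) /= big_mkcond; apply: eq_bigr => j _.
by rewrite mnmE addrK; case: (Q j).
Qed.

Lemma eta_addMr l k : eta s (k * r + l)%N = (eta s l + delta r *+ k)%MM.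
Proof.
apply/mnmP => v; rewrite mnmDE mulmnE !mnmE mul1n -addnA divnMDl //.
by rewrite addnC.
Qed.

Lemma A1r_numerator :
  \sum_(i : 'I_r.+1 | (0 < i)%N) \prod_(j : 'I_r.+1 | (i <= j)%N) y j =
  \sum_(l < r) 'X_[eta s l].
Proof.
rewrite big_mkcond big_ord_recl /= add0r (reindex_inj rev_ord_inj) /=.
apply: eq_bigr => l _; rewrite prod_shift; congr ('X_[_]).
have hl := ltn_ord l; apply/mnmP => v; rewrite !mnmE.
case: (v - s)%R => p hp /=; rewrite /bump /= add1n.
case: ltnP => h; last by rewrite divn_small; lia.
have -> : (l + p = 1 * r + (l + p - r))%N by lia.
by rewrite divnMDl // divn_small; lia.
Qed.

Lemma A1r_denominator : \prod_(j : 'I_r.+1) y j = Ymon r.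
Proof. by rewrite prod_shift; congr ('X_[_]); apply/mnmP => v; rewrite !mnmE. Qed.

(** Division with remainder of l by r enumerates the pairs of a numerator term and
    a power of Y. *)
Lemma numerator_geometric d :
  (\sum_(l < r) 'X_[eta s l]) * (\sum_(k < d) Ymon r ^+ k *+ k.+1) =
  \sum_(l < d * r) 'X_[eta s l] *+ (l %/ r).+1.
Proof.
elim: d => [|d IH]; first by rewrite !big_ord0 mulr0.
rewrite big_ord_recr mulrDr IH mulSnr big_split_ord /=; congr (_ + _).
rewrite mulr_suml; apply: eq_bigr => l _ /=.
rewrite eta_addMr mpolyXD mulrnAr /Ymon mpolyXn divnMDl //.
by rewrite divn_small // addn0.
Qed.

Lemma A1r_limitE (m : 'X_{1..r.+1}) :
  A1r_limit y m = 'X_[0%MM : 'X_{1..r.+1}]@_m +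
    (\sum_(l < (mdeg m).+1 * r) 'X_[eta s l] *+ (l %/ r).+1)@_m.
Proof.
rewrite /A1r_limit /series_add /series_of mpolyX0; congr (_ + _).
rewrite A1r_numerator A1r_denominator series_quot_square ?numerator_geometric //.
rewrite mcoeffX; case: eqP => // /mnmP/(_ ord0).
by rewrite mnmE mnm0E.
Qed.

(** Terms with l beyond the bound do not contribute at e, because each entry of
    eta s l is at least the quotient of l by r. *)
Lemma laurent_A1r_limit (e : 'cV[int]_r.+1) n :
  let m := [multinom absz (e i ord0) | i < r.+1] in
  ((mdeg m).+1 * r <= n)%N ->
  laurent_of (A1r_limit y) e =
  (e == 0)%:R + \sum_(l < n) (e == exponent (eta s l))%:R *+ (l %/ r).+1.
Proof.
move=> m hn.
have -> : laurent_of (A1r_limit y) e = laurent_of (series_of ('X_[0%MM] *+ 1)) e +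
   laurent_of (series_of
     (\sum_(l < (mdeg m).+1 * r) 'X_[eta s l] *+ (l %/ r).+1)) e.
  rewrite /laurent_of; case: ifP => _; last by rewrite addr0.
  by rewrite -/m A1r_limitE.
rewrite laurent_ofX mulr1n exponent0; congr (_ + _).
rewrite laurent_of_sum.
under eq_bigr do rewrite laurent_ofX.
rewrite (big_ord_widen n (fun l => (e == exponent (eta s l))%:R *+ (l %/ r).+1) hn).
rewrite big_mkcond; apply: eq_bigr => l _; case: ltnP => // hl.
have [El|_] := eqVneq e _; last by rewrite mul0rn.
have Em : m = eta s l by rewrite /m El exponentK.
have h1 : (m ord0 <= mdeg m)%N by rewrite mdegE (bigD1 ord0) //= leq_addr.
have h2 : ((mdeg m).+1 <= m ord0)%N.
  by rewrite {2}Em mnmE leq_divRL // (leq_trans hl) // leq_addr.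
by lia.
Qed.
End Limit.

Section Deformed.
Variable r : nat.
Hypothesis hr : (0 < r)%N.
Notation q0 := (@A1r_quiver r).
Notation mu := (@cyclic_sequence r).

Definition deformed (n : nat) : laurent r.+1 :=
  monomial_subst (- invmx (Cmatrix q0 mu n)) (Fpol r (n + r)).

Lemma deformedP n : (0 < n)%N -> is_deformed_Fpolynomial q0 mu n (deformed n).
Proof.
move=> hn; exists (Fpol r (n + r)); split=> //; last by rewrite Cmatrix_Cm ?Cm_unit.
have [_ _ _ Ex _] := seedE hr n; rewrite /is_Fpolynomial Ex.
congr (tofrac (Fpol r (n + _))).
case: n hn {Ex} => // n _; have -> : mu n.+1 = inZp n by [].
by rewrite pos_succ // pos_mut.
Qed.

(** Put m = - C_n e.  The difference of the entries of m at the first and the last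
    vertex is an expression in e alone, and it has to be at least 2.  But then
    the first entry is at least 2 n / r up to a bounded error, while in the
    support it is at most n / r + 1. *)
Lemma remainder_vanishes n (e : 'cV[int]_r.+1) (R : {mpoly int[r.+1]}) :
  supported 2 (n + r) R ->
  let B : int := \sum_(v < r.+1) `|e v ord0| in
  (r * (absz B).+1 < n)%N ->
  laurent_of (series_of R) (- (Cm r n *m e)) = 0.
Proof.
move=> hR B hn; apply/eqP; apply/negPn/negP => /laurent_of_neq0[m Eu /hR[h1 h2]].
pose W (p : nat) : int := e (inord p + inZp n) ord0.
have hW v : e v 0 = W (pos n v).
  by rewrite /W inord_val /pos subrK.
have Em i : (m i)%:Z = - ((Cm r n *m e) i 0).
  by have /matrixP/(_ i ord0) := Eu; rewrite !mxE => <-.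
have hB : `|\sum_(p < r) W p * (hstep r (n + p) 0)%:Z| <= B.
  have -> : B = \sum_(p < r.+1) `|W p|.
    rewrite -(big_pos _ n (fun p : 'I_r.+1 => `|W p|)).
    by apply: eq_bigr => v _; rewrite -hW.
  rewrite big_ord_recr /=; apply: ler_wpDr => //.
  apply: le_trans (ler_norm_sum _ _ _) _; apply: ler_sum => p _.
  by rewrite normrM ler_piMr //; case: (hstep _ _ _).
(* The rows of the first and of the last vertex have the same indicators and
   differ by one in gcol, so the difference of these entries of m is W r - W 0. *)
have hr1 (s : nat) : hstep r s 0 = hstep r s r.
  by rewrite /hstep subn0 addnK dvdn_addl.
have g0 : gcol r n 0 = gcol r n r + 1.
  rewrite /gcol; have -> : (n + r + r - 1 = 1 * r + (n + r + r - r.+1))%N by lia.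
  by rewrite divnMDl //; lia.
have gn : n%:Z <= r%:Z * gcol r n 0.
  rewrite /gcol; have := divn_eq (n + r + r - 1) r.
  have := ltn_pmod (n + r + r - 1) hr; nia.
have := Em ord0; have := Em ord_max; rewrite !(Cm_mul hr _ hW) /= g0.
rewrite (eq_bigr (fun p : 'I_r => W p * (hstep r (n + p) 0)%:Z)) => [|p _]; last first.
  by rewrite hr1.
move: hB; set S0 := \sum_(p < r) _ => hB Er E0.
rewrite g0 in gn; move: (gcol r n r) gn Er E0 => g gn Er E0.
have hk : 2 <= W r - W 0%N by lia.
have hB0 : B = (absz B)%:Z by rewrite gez0_abs // sumr_ge0.
have hS : r%:Z * S0 <= r%:Z * (absz B)%:Z by rewrite ler_wpM2l //; lia.
have hrg : n%:Z *+ 2 <= (r%:Z * (g + 1)) * (W r - W 0%N) by rewrite mulr2n; nia.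
have : r%:Z * (m ord0)%:Z <= n%:Z + r%:Z by lia.
by rewrite E0; nia.
Qed.

Lemma deformed_converges a : converges_along r.+1 a deformed
  (A1r_limit (fun j : 'I_r.+1 => 'X_(j + inZp a)%R : {mpoly int[r.+1]})).
Proof.
move=> e; set m := [multinom absz (e i ord0) | i < r.+1].
set B : int := \sum_(v < r.+1) `|e v ord0|.
exists (maxn ((mdeg m).+1 * r) (r * (absz B).+1).+1) => n.
rewrite geq_max => /andP[hn1 hn2] hna.
have Es : inZp a = inZp n :> 'I_r.+1 by apply/val_inj.
rewrite Es (laurent_A1r_limit hr _ hn1) /deformed Cmatrix_Cm //.
rewrite monomial_subst_inv ?Cm_unit //.
have -> : Fpol r (n + r) = 'X_[0%MM] *+ 1 + Lin r n +
    (Fpol r (n + r) - 1 - Lin r n) by rewrite mulr1n mpolyX0; ring.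
have hR : supported 2 (n + r) (Fpol r (n + r) - 1 - Lin r n).
  by have := @Fpol_linear_part r hr (n + r); rewrite addnK.
rewrite laurent_ofD (remainder_vanishes hR hn2) addr0 laurent_ofD laurent_ofX.
rewrite laurent_of_sum (reindex_inj rev_ord_inj) /=.
have expE m' e' : Cm r n *m exponent e' = - exponent m' ->
  (- (Cm r n *m e) == exponent m') = (e == exponent e').
  move=> E; rewrite eqr_oppLR -E; apply/eqP/eqP => [|->] //.
  exact: (can_inj (mulKmx (Cm_unit hr n))).
rewrite mulr1n (expE _ 0%MM) ?exponent0 ?mulmx0 ?oppr0 //; congr (_ + _).
apply: eq_bigr => l _; rewrite laurent_ofX (expE _ _ (Cm_eta hr (ltn_ord l))).
by congr (_ *+ (_ %/ r).+1); have := ltn_ord l; lia.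
Qed.
End Deformed.

Theorem theorem7p3 (r : nat) (hr : (1 <= r)%N) :
  exists S : nat -> laurent r.+1,
    (forall n : nat, (0 < n)%N ->
       is_deformed_Fpolynomial (@A1r_quiver r) (@cyclic_sequence r) n (S n)) /\
    (forall a : nat, exists s : 'I_r.+1,
       converges_along r.+1 a S
         (A1r_limit (fun j : 'I_r.+1 => 'X_(j + s)%R : {mpoly int[r.+1]}))).
Proof.
exists (@deformed r); split; first exact: deformedP.
by move=> a; exists (inZp a); exact: deformed_converges.
Qed.
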